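(* Let $\theta\ge1$, $M,N,\eta>0$, $\lambda>\frac12$, $\eta_0\ge0$, $R\ge1$ be constants and let $\rho:\mathbb Z^+\to(0,\infty)$ satisfy $\sum_{i}\rho(i)<\infty$ and $\rho(\gamma)/\rho(j)\le N$ whenever $|\gamma-j|\le R$. Let $a_{i,i-1},a_{i-1,i}$ ($i\ge2$) be real numbers with $a_{i,i-1}\ne0$ and $\max\{|a_{i-1,i}|,|a_{i,i-1}|\}\le M$ for all $i\ge2$. Let $f\in C^\infty(\mathbb R,\mathbb R)$ satisfy $f(z)z\le\eta-\lambda|z|^2$ and $|f(z)|\le\eta_0(1+|z|^\theta)$ for all $z\in\mathbb R$. Assume $2M<\lambda-\frac12$. Assume moreover that there are $r,M_1,M_2>0$ and $N_1\in\mathbb Z^+$ with $\rho(n)\ge M_1e^{-rn}$ for all $n\ge N_1$ and $\limsup_{n\to\infty}\rho(n)/\inf_{1\le i\le n}\rho(i)\le M_2$; and that $f=f_1+f_2+f_3$, where $f_2$ is globally Lipschitz, there is $\xi\in\mathbb R$ such that $z\mapsto f_3(z)+\xi z$ is monotonically decreasing, and $|f_1(z)-f_1(\tilde z)|\le L(n)|z-\tilde z|$ for all $n\in\mathbb N$ and $z,\tilde z\in[-n,n]$, where $L:\mathbb N\to(0,\infty)$ is such that for every $C>0$ there is $\gamma=\gamma(C)>0$ with $\lim_{n\to\infty}\frac{\exp\{CL^2(n)\}}{n^\gamma L(n)}=0$. Assume finally that $\lambda>\frac{2MN+2(2\theta-1)M}{2\theta}+\theta+\eta+\frac1{2\theta}-\frac12$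 and that there exists $v:\mathbb Z^+\to(0,\infty)$ with $\sum_iv(i)<\infty$ and $\sum_i\frac{\rho(i)}{v(i)}<\infty$. For $n\in\mathbb N$ let $\mu_n$ be the unique invariant measure on $\mathbb R^n$ of the finite-volume system $X^{(n)}$, and $\nu_n=\mu_n\circ\chi_n^{-1}$. Then the sequence of measures $\{\nu_n\}$ is tight in $\ell^{2\theta}_\rho(\mathbb Z^+)$.
   Context: $\mathbb Z^+=\{1,2,\dots\}$; $\ell^p_\rho(\mathbb Z^+)=\{x:\|x\|_{p,\rho}^p:=\sum_\gamma|x_\gamma|^p\rho(\gamma)<\infty\}$. The finite-volume system is $$dX^{(n)}_i(t)=\big(a_{i,i-1}X^{(n)}_{i-1}(t)+a_{i,i+1}X^{(n)}_{i+1}(t)+f(X^{(n)}_i(t))\big)dt+\mathbf 1_{\{i=1\}}dW_1(t),\quad 1\le i\le n,$$ with the conventions $a_{1,0}=0$, $X^{(n)}_0=X^{(n)}_{n+1}=0$ and $W_1$ a one-dimensional Brownian motion; under the hypotheses it has a unique invariant measure $\mu_n$. $\chi_n:\mathbb R^n\to\mathbb R^{\mathbb Z^+}$, $\chi_n(x_1,\dots,x_n)=(x_1,\dots,x_n,0,0,\dots)$. *)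

(* Defs.v *)
From HB Require Import structures.
From mathcomp Require Import all_boot all_order all_algebra.
From mathcomp Require Import ring lra.
From mathcomp Require Import all_classical all_reals all_analysis.

Set Implicit Arguments.
Unset Strict Implicit.
Unset Printing Implicit Defensive.

Import Order.TTheory GRing.Theory Num.Def Num.Theory.
Import numFieldNormedType.Exports.

Local Open Scope classical_set_scope.
Local Open Scope ring_scope.

(* Conventions on Z^+ = {1, 2, ...}.  Weights and interaction coefficients are
   functions of nat of which only the values at positive arguments are ever
   used.  A point (x_1, x_2, ...) of R^{Z^+} is the function k |-> x_{k+1} on
   nat, and a point (x_1, ..., x_n) of R^n is an n-tuple. *)

(* ||x||_{p,rho}^p = sum_{g >= 1} |x_g|^p rho(g), with g = k + 1. *)
Definition lp_sum (R : realType) (p : R) (rho : nat -> {posnum R})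
    (x : nat -> R) : \bar R :=
  (\sum_(0 <= k <oo) (`|x k| `^ p * (rho k.+1)%:num)%:E)%E.

Definition in_lp (R : realType) (p : R) (rho : nat -> {posnum R}) :
    {pred nat -> R} :=
  fun x => (lp_sum p rho x < +oo)%E.

(* The space l^p_rho(Z^+); the proof of 1 <= p is a parameter of the type
   because it is what makes the norm below a norm. *)
Record lp (R : realType) (p : R) (p1 : 1 <= p) (rho : nat -> {posnum R}) :=
  Lp { lp_val :> nat -> R ; lp_valP : lp_val \in in_lp p rho }.

Section lp_normed_space.
Context (R : realType) (p : R) (p1 : 1 <= p) (rho : nat -> {posnum R}).
Implicit Types (x y : nat -> R) (c : R).

Let S := lp_sum p rho.

Let p0 : 0 < p. Proof. exact: lt_le_trans p1. Qed.

Lemma lp_term_ge0 x k : 0 <= `|x k| `^ p * (rho k.+1)%:num.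
Proof. by rewrite mulr_ge0// powR_ge0. Qed.

Lemma lp_sum_ge0 x : (0 <= S x)%E.
Proof. by apply: nneseries_ge0 => k _ _; rewrite lee_fin lp_term_ge0. Qed.

Lemma lp_sumZ c x : S (c *: x) = ((`|c| `^ p)%:E * S x)%E.
Proof.
rewrite /S /lp_sum -nneseriesZl; last by move=> k _; rewrite lee_fin lp_term_ge0.
by apply: eq_eseriesr => k _; rewrite -EFinM /= normrM powRM// mulrA.
Qed.

Lemma lp_sum0 : S 0 = 0%E.
Proof. by rewrite -(scale0r (0 : nat -> R)) lp_sumZ normr0 powR0 ?mul0e// gt_eqF. Qed.

Lemma lp_sum_fine x : x \in in_lp p rho -> S x = (fine (S x))%:E.
Proof. by move=> xp; rewrite fineK// ge0_fin_numE// lp_sum_ge0. Qed.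

Lemma lp_sum_eq0 x : S x = 0%E -> x = 0.
Proof.
move=> Sx0; apply/funext => k.
have term0 j : (0 <= (`|x j| `^ p * (rho j.+1)%:num)%:E)%E.
  by rewrite lee_fin lp_term_ge0.
have : ((`|x k| `^ p * (rho k.+1)%:num)%:E <= S x)%E.
  rewrite /S /lp_sum (nneseriesD1 (n := k)) => [|j _|//]; last exact: term0.
  by apply: leeDl; exact: nneseries_ge0.
rewrite Sx0 => /(conj (term0 k))/andP/le_anti/esym/eqP; rewrite eqe.
rewrite mulf_eq0 powR_eq0 normr_eq0 => /orP[/andP[/eqP//]|].
by rewrite gt_eqF.
Qed.

Lemma lp_sum_convex (t : R) x y : 0 <= t <= 1 ->
  (S ((fun k => t * x k + (1 - t) * y k)%R) <=
   t%:E * S x + (1 - t)%:E * S y)%E.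
Proof.
move=> /andP[t0 t1].
have s0 : 0 <= 1 - t by rewrite subr_ge0.
have term0 (z : nat -> R) k : (0 <= (`|z k| `^ p * (rho k.+1)%:num)%:E)%E.
  by rewrite lee_fin lp_term_ge0.
have termZ0 c (z : nat -> R) k : 0 <= c -> (0 <= c%:E * (`|z k| `^ p * (rho k.+1)%:num)%:E)%E.
  by move=> c0; rewrite mule_ge0// lee_fin.
rewrite /S /lp_sum -2?nneseriesZl//= -nneseriesD//; try by move=> *; exact: termZ0.
apply: lee_nneseries => [k _ _|k _]; first exact: (term0 (fun k => t * x k + (1 - t) * y k)).
rewrite -!EFinM -EFinD lee_fin !mulrA -mulrDl ler_wpM2r//=.
apply: (@le_trans _ _ ((t * `|x k| + (1 - t) * `|y k|) `^ p)).
  apply: ge0_ler_powR; rewrite ?nnegrE ?(ltW p0)//.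
    by rewrite addr_ge0// mulr_ge0.
  apply: le_trans (ler_normD _ _) _; rewrite !normrM.
  by rewrite (ger0_norm t0) (ger0_norm s0).
have t01 : 0 <= t <= 1 by rewrite t0.
have := @convex_powR _ _ p1 (Itv01 t0 t1) `|x k| `|y k|.
rewrite !inE /= !in_itv /= !andbT => /(_ (normr_ge0 _) (normr_ge0 _)).
by rewrite !convRE.
Qed.

Lemma lp_submod_closed : submod_closed (in_lp p rho).
Proof.
have Zc c x : x \in in_lp p rho -> c *: x \in in_lp p rho.
  rewrite !unfold_in /in_lp -!/(S _) lp_sumZ => xp.
  by rewrite lte_mul_pinfty// lee_fin powR_ge0.
split; first by rewrite unfold_in /in_lp -/(S _) lp_sum0.
move=> c x y /(Zc c); move: (c *: x) => {}x xp yp.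
have -> : x + y = 2 *: ((fun k => 2^-1 * x k + (1 - 2^-1) * y k) : nat -> R).
  have half (u w : R) : u + w = 2 * (2^-1 * u + (1 - 2^-1) * w) by field.
  by apply/funext => k; apply: etrans (half (x k) (y k)) _.
apply: Zc; rewrite unfold_in; apply: le_lt_trans (lp_sum_convex _ _ _) _.
  by rewrite invr_ge0 ler0n invf_le1// ler1n.
rewrite (lp_sum_fine xp) (lp_sum_fine yp) -!EFinM -EFinD; exact: ltry.
Qed.

HB.instance Definition _ := GRing.isSubmodClosed.Build _ _ (in_lp p rho)
  lp_submod_closed.

HB.instance Definition _ := [isSub for @lp_val R p p1 rho].
HB.instance Definition _ := [Choice of lp p1 rho by <:].
HB.instance Definition _ := [SubChoice_isSubLmodule of lp p1 rho by <:].

Definition lp_norm (x : lp p1 rho) : R := fine (lp_sum p rho x) `^ p^-1.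

Lemma lp_normZ c (x : lp p1 rho) : lp_norm (c *: x) = `|c| * lp_norm x.
Proof.
rewrite /lp_norm -/(S _) lp_sumZ (lp_sum_fine (lp_valP x)) -EFinM /=.
rewrite powRM ?powR_ge0// ?fine_ge0 ?lp_sum_ge0//.
by rewrite -powRrM mulfV ?gt_eqF// powRr1.
Qed.

Lemma lp_norm_eq0 (x : lp p1 rho) : lp_norm x = 0 -> x = 0.
Proof.
move=> /powR_eq0_eq0 x0; apply/val_inj/lp_sum_eq0.
by rewrite (lp_sum_fine (lp_valP x)) -/S x0.
Qed.

Lemma lp_sum_norm (x : lp p1 rho) : S x = (lp_norm x `^ p)%:E.
Proof.
rewrite (lp_sum_fine (lp_valP x)) /lp_norm -powRrM mulVf ?gt_eqF// powRr1//.
by rewrite fine_ge0// lp_sum_ge0.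
Qed.

Lemma lp_sum_unit (x : lp p1 rho) :
  0 < lp_norm x -> S ((lp_norm x)^-1 *: (x : nat -> R)) = 1%E.
Proof.
move=> x0; rewrite lp_sumZ lp_sum_norm -EFinM -powRM; last 2 first.
- exact: normr_ge0.
- exact: ltW.
by rewrite ger0_norm ?invr_ge0 ?ltW// mulVf ?gt_eqF// powR1.
Qed.

Lemma ler_lp_normD (x y : lp p1 rho) : lp_norm (x + y) <= lp_norm x + lp_norm y.
Proof.
have [/lp_norm_eq0->|a0] := eqVneq (lp_norm x) 0.
  by rewrite add0r lerDr powR_ge0.
have [/lp_norm_eq0->|b0] := eqVneq (lp_norm y) 0.
  by rewrite addr0 lerDl powR_ge0.
have {}a0 : 0 < lp_norm x by rewrite lt_neqAle eq_sym a0; exact: powR_ge0.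
have {}b0 : 0 < lp_norm y by rewrite lt_neqAle eq_sym b0; exact: powR_ge0.
have Sx1 := lp_sum_unit a0; have Sy1 := lp_sum_unit b0.
have := lp_sum_norm (x + y).
have : 0 <= lp_norm (x + y) by exact: powR_ge0.
move: (lp_norm (x + y)) => c c0.
move: (lp_norm x) (lp_norm y) a0 b0 Sx1 Sy1 => a b a0 b0 Sx1 Sy1 Sxy.
have ab0 : 0 < a + b by rewrite addr_gt0.
pose t := a / (a + b).
have t1E : 1 - t = b / (a + b).
  by rewrite /t -[1](@divff _ (a + b)) ?gt_eqF// -mulrBl addrAC subrr add0r.
have t01 : 0 <= t <= 1.
  rewrite /t; apply/andP; split; first by rewrite divr_ge0 ?(ltW a0) ?(ltW ab0).
  by rewrite ler_pdivrMr// mul1r lerDl ltW.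
have := lp_sum_convex (a^-1 *: (x : nat -> R)) (b^-1 *: (y : nat -> R)) t01.
rewrite Sx1 Sy1 !mule1 -EFinD addrCA subrr addr0.
set u := (X in S X) => Su1.
have xyE : (x + y : nat -> R) = (a + b) *: u.
  have split (z w : R) :
      z + w = (a + b) * (t * (a^-1 * z) + (1 - t) * (b^-1 * w)).
    by rewrite t1E /t; field; rewrite !gt_eqF.
  by apply/funext => k; exact: split.
have le_p : c `^ p <= (a + b) `^ p.
  rewrite -lee_fin -Sxy; have -> : lp_val (x + y) = (a + b) *: u by [].
  rewrite lp_sumZ (ger0_norm (ltW ab0)) -[leRHS]mule1.
  by rewrite lee_pmul2l// lte_fin powR_gt0.
rewrite leNgt; apply/negP => /(gt0_ltr_powR p0); rewrite !nnegrE (ltW ab0) c0.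
by move=> /(_ isT isT); rewrite ltNge le_p.
Qed.

HB.instance Definition _ := @Lmodule_isNormed.Build R (lp p1 rho) lp_norm
  ler_lp_normD lp_normZ lp_norm_eq0.

End lp_normed_space.

Lemma ge1_mul2 (R : realType) (theta : R) : 1 <= theta -> 1 <= 2 * theta.
Proof. by move=> h; lra. Qed.

Section stochastic_basis.
Context (R : realType) d (Omega : measurableType d) (P : probability Omega R).
Implicit Type F : R -> set_system Omega.

Definition filtration F : Prop :=
  (forall t, 0 <= t -> sigma_algebra setT (F t) /\ F t `<=` measurable) /\
  (forall s t, 0 <= s -> s <= t -> F s `<=` F t).

Definition adapted d' (T : measurableType d') F (X : R -> Omega -> T) : Prop :=
  forall t, 0 <= t -> forall B, measurable B -> F t (X t @^-1` B).

Definition increment (W : R -> Omega -> R) (s t : R) : Omega -> R :=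
  fun w => W t w - W s w.

(* Standard one-dimensional Brownian motion with respect to F: the increment
   W_t - W_s is independent of F_s with law N(0, t - s).  The second parameter
   of normal_prob is the standard deviation. *)
Definition brownian_motion F (W : R -> Omega -> R) : Prop :=
  [/\ adapted F W,
      {ae P, forall w, W 0 w = 0},
      {ae P, forall w, {within `[0, +oo[, continuous (fun t => W t w)}} &
      forall s t, 0 <= s -> s < t -> forall B, measurable B ->
        P (increment W s t @^-1` B) = normal_prob 0 (Num.sqrt (t - s)) B
        /\ forall A, F s A ->
          P (A `&` increment W s t @^-1` B) =
          (P A * P (increment W s t @^-1` B))%E].

End stochastic_basis.

Section finite_volume_system.
Context (R : realType).

(* site x i is x_i for 1 <= i <= n, and 0 for i = 0 and for i > n. *)
Definition site n (x : n.-tuple R) (i : nat) : R := (0 :: tval x)`_i.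

(* The i-th drift coefficient.  For i = 1 the term a_{1,0} x_0 vanishes since
   site x 0 = 0, so that the value of a 1 0 is irrelevant. *)
Definition drift (a : nat -> nat -> R) (f : R -> R) n (x : n.-tuple R)
    (i : nat) : R :=
  a i i.-1 * site x i.-1 + a i i.+1 * site x i.+1 + f (site x i).

Context d (Omega : measurableType d) (P : probability Omega R).

(* X is the solution with X_0 = x0.  The noise being additive, the stochastic
   equation is a pathwise integral equation. *)
Definition solution (F : R -> set_system Omega) (W : R -> Omega -> R)
    (a : nat -> nat -> R) (f : R -> R) n (x0 : n.-tuple R)
    (X : R -> Omega -> n.-tuple R) : Prop :=
  [/\ adapted F X,
      {ae P, forall w i, {within `[0, +oo[, continuous (fun t => site (X t w) i)}} &
      {ae P, forall w t i, 0 <= t -> (1 <= i <= n)%N ->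
        site (X t w) i = site x0 i
          + (\int[lebesgue_measure]_(s in `[0, t]) drift a f (X s w) i)
          + (i == 1%N)%:R * W t w}].

(* X x is the process started at x; P (X x t \in B) is the transition
   probability P_t(x, B). *)
Definition invariant_measure n (X : n.-tuple R -> R -> Omega -> n.-tuple R)
    (mu : probability (n.-tuple R) R) : Prop :=
  forall t, 0 <= t -> forall B, measurable B ->
    mu B = (\int[mu]_x P (X x t @^-1` B))%E.

Definition unique_invariant_measure n
    (X : n.-tuple R -> R -> Omega -> n.-tuple R)
    (mu : probability (n.-tuple R) R) : Prop :=
  invariant_measure X mu /\
  forall mu' : probability (n.-tuple R) R, invariant_measure X mu' ->
    forall B, measurable B -> mu' B = mu B.

End finite_volume_system.

Section tightness.
Context (R : realType).

(* chi_n (x_1, ..., x_n) = (x_1, ..., x_n, 0, 0, ...). *)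
Definition chi n (x : n.-tuple R) : nat -> R := fun k => site x k.+1.

(* nu_n = mu_n o chi_n^{-1}. *)
Definition image_measure n (mu : probability (n.-tuple R) R)
    (A : set (nat -> R)) : \bar R := mu (@chi n @^-1` A).

(* Compactness is that of the norm topology of l^p_rho(Z^+), which is embedded
   in R^{Z^+} by lp_val. *)
Definition tight_in_lp (p : R) (p1 : 1 <= p) (rho : nat -> {posnum R})
    (nu : nat -> set (nat -> R) -> \bar R) : Prop :=
  forall e : R, 0 < e -> exists2 K : set (lp p1 rho), compact K &
    forall n, (1 <= n)%N -> (nu n (~` (@lp_val R p p1 rho @` K)) <= e%:E)%E.

End tightness.

(* Main.v *)
Require Import Defs.
From HB Require Import structures.
From mathcomp Require Import all_boot all_order all_algebra.
From mathcomp Require Import ring lra.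
From mathcomp Require Import all_classical all_reals all_analysis.
From mathcomp Require Import measurable_realfun.

Set Implicit Arguments.
Unset Strict Implicit.
Unset Printing Implicit Defensive.

Import Order.TTheory GRing.Theory Num.Def Num.Theory.
Import numFieldNormedType.Exports.

Local Open Scope classical_set_scope.
Local Open Scope ring_scope.

(** Every [mu_n] gives mass at least [1 - O(1 / c)] to the cube
    [max_i |x_i| <= c], with a constant that does not depend on [n]; and the
    cube of [l^p_rho], [p = 2 theta], is compact because [rho] is summable
    ([compact_lp_box]).  Tightness follows.

    The uniform estimate needs no stochastic calculus.  The noise is additive
    and enters at the first site only, so that [Y_i = X_i - 1_{i = 1} W] solves
    an ordinary differential equation along each path.  The dissipativity
    [f(z) z <= eta - lambda z^2] beats the coupling with the two neighbours,
    of strength at most [2 M < lambda - 1/2], at the site where [|Y_i|] is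
    largest.  A maximum principle in [(t, i)] then gives, when
    [|W| <= u] on [[0, 1]],
      [max_i |X_i(1)| <= 2/3 max_i |X_i(0)| + D (1 + u)],
    where [D] depends on [M], [lambda] and [eta] only
    ([one_step_contraction]).  The supremum [u] of the path is controlled by
    Gaussian tails and dyadic chaining: it exceeds [u] with probability
    [O(1 / u)] ([brownian_sup_tail]).

    Invariance at time 1 turns these two facts into
      [T(c) <= T(5 c / 4) + A / c]   for   [T(c) = mu_n (max_i |x_i| > c)],
    since a path that starts in the cube of size [5 c / 4] leaves the cube of
    size [c] only if its noise is of order [c].  As [5 A / c] solves the
    corresponding equation, [T(c) - 5 A / c] does not decrease when [c] is
    multiplied by [5/4]; it is at most its limit along [c (5/4)^k], which is
    0 since [mu_n] is a probability ([le_of_dilation_step]). *)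

(** * Compact cubes in the weighted sequence space *)

Lemma lp_norm_lt (R : realType) (p : R) (p1 : 1 <= p) (rho : nat -> {posnum R})
    (x : lp p1 rho) (e : R) :
  0 <= e -> (lp_sum p rho x < (e `^ p)%:E)%E -> `|x| < e.
Proof.
move=> e0; rewrite (@lp_sum_norm R p p1 rho x) lte_fin => h.
rewrite ltNge; apply/negP => ex; move: h; rewrite ltNge => /negP; apply.
by apply: ge0_ler_powR; rewrite ?nnegrE ?powR_ge0//; exact: le_trans ler01 p1.
Qed.

Lemma weight_shiftE (R : realType) (rho : nat -> {posnum R}) N :
  (\sum_(N <= k <oo) ((rho k.+1)%:num)%:E =
   \sum_(N.+1 <= k <oo) ((rho k)%:num)%:E)%E.
Proof.
rewrite -(@nneseries_addn _ (fun k => ((rho k)%:num)%:E) N.+1)//.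
rewrite -(@nneseries_addn _ (fun k => ((rho k.+1)%:num)%:E) N)//.
by apply: eq_eseriesr => i _; rewrite addnS.
Qed.

Lemma bounded_in_lp (R : realType) (p : R) (rho : nat -> {posnum R}) (c : R)
    (y : nat -> R) :
    0 <= p -> (\sum_(1 <= i <oo) ((rho i)%:num)%:E < +oo)%E ->
  (forall k, `|y k| <= c) -> y \in in_lp p rho.
Proof.
move=> p0 rho_sum yc; have c0 : 0 <= c by exact: le_trans (yc 0%N).
rewrite unfold_in /in_lp /lp_sum.
apply: (@le_lt_trans _ _
    (\sum_(0 <= k <oo) ((c `^ p)%:E * ((rho k.+1)%:num)%:E))%E).
  apply: lee_nneseries => k _ => [_|].
    by rewrite lee_fin mulr_ge0// powR_ge0.
  rewrite -EFinM lee_fin ler_wpM2r//.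
  by apply: ge0_ler_powR; rewrite ?nnegrE.
by rewrite nneseriesZl// weight_shiftE lte_mul_pinfty// lee_fin powR_ge0.
Qed.

(** On a cube the weighted tails are uniformly small, since they are bounded by
    those of the summable weight; hence convergence of the coordinates is
    convergence in norm, and an ultrafilter on the cube converges in each
    coordinate. *)
Lemma compact_lp_box (R : realType) (p : R) (p1 : 1 <= p)
    (rho : nat -> {posnum R}) (c : R) :
  (\sum_(1 <= i <oo) ((rho i)%:num)%:E < +oo)%E ->
  compact [set x : lp p1 rho | forall k, `|x k| <= c].
Proof.
move=> rho_sum.
have p0 : 0 < p by exact: lt_le_trans p1.
have rhoE0 i : (0 <= ((rho i)%:num)%:E)%E by rewrite lee_fin.
have tot : (\sum_(0 <= k <oo) ((rho k.+1)%:num)%:E < +oo)%E by rewrite weight_shiftE.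
rewrite compact_ultra => F FU FK.
have PF : ProperFilter (F : set_system (lp p1 rho)) := @ultra_proper _ F FU.
have FF : Filter (F : set_system (lp p1 rho)) := @filter_filter _ F PF.
have /boolp.choice[y yP] : forall k, exists z : R, `|z| <= c /\
    (fun x : lp p1 rho => x k) @ F --> z.
  move=> k.
  have FB : ((fun x : lp p1 rho => x k) @ F) [set` `[- c, c]%R].
    apply: (@filterS (lp p1 rho) F FF _ _ _ FK) => x /= /(_ k).
    by rewrite in_itv /= ler_norml.
  have [z [/= zc zF]] := @segment_compact R (- c) c _ _ FB.
  exists z; split; first by move: zc; rewrite in_itv /= ler_norml.
  (* A cluster point of an ultrafilter is a limit. *)
  move=> V Vz; have [//|FV] := in_ultra_setVsetC ((fun x : lp p1 rho => x k) @^-1` V) FU.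
  have [w [/= nVw Vw]] := zF (~` V) V FV Vz.
  by [].
have yc k : `|y k| <= c by case: (yP k).
have c0 : 0 <= c by exact: le_trans (yc 0%N).
exists (@Lp R p p1 rho y (bounded_in_lp (ltW p0) rho_sum yc)); split => //=.
apply/cvgrPdist_lt => e e0.
have ep0 : 0 < e `^ p by rewrite powR_gt0.
set T := (\sum_(0 <= k <oo) ((rho k.+1)%:num)%:E)%E in tot.
have Tfin : T \is a fin_num.
  by rewrite ge0_fin_numE//; apply: nneseries_ge0.
(* The tail from [m] on and the first [m] terms each get half of [e `^ p];
   two points of the cube differ by at most [2 c] in each coordinate. *)
pose C := (2 * c) `^ p + 1.
have C0 : 0 < C by rewrite ltr_wpDl// powR_ge0.
have [m tailm] : exists m,
    (\sum_(m <= k <oo) ((rho k.+1)%:num)%:E < (e `^ p / 2 / C)%:E)%E.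
  have := @nneseries_tail_cvg R (fun k => ((rho k.+1)%:num)%:E) xpredT tot.
  move=> /(_ (fun k _ => rhoE0 _)) tl.
  have d0 : 0 < e `^ p / 2 / C by rewrite !divr_gt0.
  have [|N _ hN] := tl [set s | (s < (e `^ p / 2 / C)%:E)%E].
    by apply: open_ereal_lt'; rewrite lte_fin.
  by exists N; exact: hN (leqnn N).
pose D := fine T + 1.
have D0 : 0 < D by rewrite ltr_wpDl// fine_ge0// nneseries_ge0.
pose del := (e `^ p / 2 / D) `^ p^-1.
have del0 : 0 < del by rewrite powR_gt0// !divr_gt0.
have near_m : \forall x \near F, forall k : 'I_m, `|y k - lp_val x k| < del.
  apply: filter_forall => k.
  have [_ /cvgrPdist_lt /(_ _ del0)] := yP k; exact.
near=> x.
apply: lp_norm_lt; first exact: ltW.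
have xc k : `|lp_val x k| <= c by move: k; near: x.
have xm (k : 'I_m) : `|y k - lp_val x k| < del by move: k; near: x.
set z := lp_val _.
have zE k : z k = y k - lp_val x k by [].
have z2 k : `|z k| <= 2 * c.
  by rewrite zE (le_trans (ler_normB _ _))// mulr2n mulrDl mul1r lerD.
have term0 k : (0 <= (`|z k| `^ p * (rho k.+1)%:num)%:E)%E.
  by rewrite lee_fin mulr_ge0// powR_ge0.
rewrite /lp_sum (nneseries_split _ m)//= add0n.
have -> : e `^ p = e `^ p / 2 + e `^ p / 2 by lra.
rewrite EFinD; apply: lee_ltD.
- by rewrite sumEFin.
- apply: (@le_trans _ _ (\sum_(0 <= k < m) ((e `^ p / 2 / D)%:E * ((rho k.+1)%:num)%:E))%E).
    rewrite !big_mkord; apply: lee_sum => k _; rewrite -EFinM lee_fin ler_wpM2r//.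
    have -> : e `^ p / 2 / D = del `^ p.
      by rewrite /del -powRrM mulVf ?gt_eqF// powRr1// ltW// !divr_gt0.
    apply: ge0_ler_powR; rewrite ?nnegrE ?(ltW p0) ?(ltW del0)// zE.
    exact/ltW/xm.
  rewrite -ge0_sume_distrr//.
  apply: (@le_trans _ _ ((e `^ p / 2 / D)%:E * T)%E).
    rewrite lee_pmul2l ?lte_fin ?divr_gt0//.
    exact: nneseries_lim_ge.
  rewrite -(fineK Tfin) -EFinM lee_fin -[leRHS](divfK (lt0r_neq0 D0)).
  by rewrite ler_wpM2l// ?divr_ge0 ?(ltW ep0) ?(ltW D0)// lerDl.
- apply: (@le_lt_trans _ _ (\sum_(m <= k <oo) (((2 * c) `^ p)%:E * ((rho k.+1)%:num)%:E))%E).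
    apply: lee_nneseries => // k _; rewrite -EFinM lee_fin ler_wpM2r//.
    by apply: ge0_ler_powR; rewrite ?nnegrE ?(ltW p0)// mulr_ge0.
  rewrite nneseriesZl//.
  apply: (@le_lt_trans _ _ (C%:E * \sum_(m <= k <oo) ((rho k.+1)%:num)%:E)%E).
    by rewrite lee_wpmul2r ?nneseries_ge0// lee_fin lerDl.
  rewrite -[ltRHS](_ : (C%:E * (e `^ p / 2 / C)%:E)%E = _).
    by rewrite lte_pmul2l.
  by rewrite -EFinM mulrC divfK ?gt_eqF.
Unshelve. all: by end_near. Qed.

(** * Maximal function of Brownian motion *)

Lemma measurable_norm_gt (R : realType) (a : R) :
  measurable [set x : R | a < `|x|].
Proof.
apply: open_measurable.
apply: (@open_comp _ _ (fun x : R => `|x|) [set y | a < y]); last exact: open_gt.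
by move=> x _; exact: norm_continuous.
Qed.

Lemma expRN_le_inv_sqr (R : realType) (y : R) : 0 < y -> expR (- y) <= 4 / y ^+ 2.
Proof.
move=> y0; rewrite expRN -[leRHS]invrK invf_div lef_pV2 ?posrE ?expR_gt0//; last first.
  by rewrite divr_gt0// exprn_gt0.
have -> : y ^+ 2 / 4 = (y / 2) ^+ 2 by rewrite expr_div_n; congr (_ / _); ring.
have -> : expR y = expR (y / 2) ^+ 2.
  by rewrite expr2 -expRD; congr expR; lra.
rewrite lerXn2r ?nnegrE ?expR_ge0 ?divr_ge0 ?(ltW y0)//.
by apply: le_trans (expR_ge1Dx _); rewrite lerDr.
Qed.

Lemma normal_pdf_dilation (R : realType) (s x : R) : 0 < s ->
  normal_pdf 0 s x = Num.sqrt 2 * expR (- (x ^+ 2 / (4 * s ^+ 2))) *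
                     normal_pdf 0 (Num.sqrt 2 * s) x.
Proof.
move=> s0; have r0 : 0 < Num.sqrt 2 :> R by rewrite sqrtr_gt0.
have rs0 : Num.sqrt 2 * s != 0 by rewrite gt_eqF// mulr_gt0.
rewrite !normal_pdfE ?(gt_eqF s0)// /normal_peak /normal_fun !subr0.
rewrite exprMn sqr_sqrtr//.
have -> : 2 * s ^+ 2 * pi *+ 2 = 2 * (s ^+ 2 * pi *+ 2) by ring.
rewrite sqrtrM//.
set e := expR (- x ^+ 2 / _).
have -> : e = expR (- (x ^+ 2 / (4 * s ^+ 2))) * expR (- x ^+ 2 / (2 * s ^+ 2 *+ 2)).
  by rewrite -expRD; congr expR; field; rewrite gt_eqF.
have q0 : 0 < Num.sqrt (s ^+ 2 * pi *+ 2).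
  by rewrite sqrtr_gt0 pmulrn_lgt0// mulr_gt0 ?pi_gt0// exprn_gt0.
by field; rewrite !gt_eqF.
Qed.

(** The density of variance [s^2] is the density of variance [2 s^2], whose
    integral is 1, times a factor that is uniformly small on the tail; so no
    Gaussian integral has to be estimated. *)
Lemma normal_prob_tail (R : realType) (s a : R) : 0 < s -> 0 < a ->
  (normal_prob 0 s [set x | a < `|x|]%R <=
   (Num.sqrt 2 * (64 * (s / a) ^+ 4))%:E)%E.
Proof.
move=> s0 a0; set k := Num.sqrt 2 * _.
have r0 : 0 < Num.sqrt 2 :> R by rewrite sqrtr_gt0.
have k0 : 0 <= k.
  by rewrite mulr_ge0 ?sqrtr_ge0// mulr_ge0// exprn_ge0// divr_ge0 ?ltW.
have mA : measurable [set x : R | a < `|x|] by exact: measurable_norm_gt.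
have mpdf t : measurable_fun setT (fun x : R => (normal_pdf 0 t x)%:E).
  by apply/measurable_EFinP; exact: measurable_normal_pdf.
rewrite /normal_prob.
apply: (@le_trans _ _ (\int[lebesgue_measure]_(x in [set x : R | (a < `|x|)%R])
    (k%:E * (normal_pdf 0 (Num.sqrt 2 * s) x)%:E))%E).
  apply: ge0_le_integral => //.
  - by move=> x _; rewrite lee_fin normal_pdf_ge0.
  - apply: measurable_funTS; exact: mpdf.
  - by apply: measurable_funTS; apply: measurable_funeM; exact: mpdf.
  move=> x /= ax; rewrite -EFinM lee_fin normal_pdf_dilation//.
  rewrite ler_wpM2r ?normal_pdf_ge0// ler_wpM2l ?sqrtr_ge0//.
  apply: (@le_trans _ _ (expR (- (a ^+ 2 / (4 * s ^+ 2))))).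
    rewrite ler_expR lerN2 ler_pM2r ?invr_gt0 ?mulr_gt0 ?exprn_gt0//.
    rewrite -[x ^+ 2]real_normK ?num_real// lerXn2r ?nnegrE ?(ltW a0)//.
    exact: ltW.
  apply: le_trans (expRN_le_inv_sqr _) _.
    by rewrite divr_gt0 ?mulr_gt0 ?exprn_gt0.
  by rewrite le_eqVlt; apply/orP; left; apply/eqP; field; rewrite !gt_eqF.
rewrite ge0_integralZl//; last 2 first.
- apply: measurable_funTS; exact: mpdf.
- by move=> x _; rewrite lee_fin normal_pdf_ge0.
rewrite -[leRHS]mule1 lee_wpmul2l ?lee_fin//.
rewrite -(integral_normal_pdf 0 (Num.sqrt 2 * s)).
apply: ge0_subset_integral => //; first exact: mpdf.
by move=> x _; rewrite lee_fin normal_pdf_ge0.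
Qed.

Definition dyadic (R : realType) (l j : nat) : R := j%:R / 2 ^+ l.

(** A dyadic point of level [l + 1] either has level [l] or is the right end of
    one interval of level [l + 1] that starts at level [l].  The increments
    allowed at successive levels are [u (1 - q) q^l], and their sum
    over all levels is [u]. *)
Lemma dyadic_chaining (R : realType) (w : R -> R) (u q : R) :
    0 <= u -> 0 <= q <= 1 -> w 0 = 0 ->
    (forall l j, (j < 2 ^ l)%N ->
      `|w (dyadic R l j.+1) - w (dyadic R l j)| <= u * (1 - q) * q ^+ l) ->
  forall l j, (j <= 2 ^ l)%N -> `|w (dyadic R l j)| <= u.
Proof.
move=> u0 /andP[q0 q1] w0 winc l j jl.
suff /le_trans : `|w (dyadic R l j)| <= u * (1 - q ^+ l.+1).
  by apply; rewrite ler_piMr// lerBlDr lerDl exprn_ge0.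
elim: l j jl => [|l IH] j jl.
  case: j jl => [_|[_|//]].
    by rewrite /dyadic mul0r w0 normr0 expr1 mulr_ge0// subr_ge0.
  have := winc 0%N 0%N isT.
  by rewrite /dyadic mul0r w0 subr0 expr0 mulr1 expr1.
have half i : dyadic R l.+1 i.*2 = dyadic R l i.
  rewrite /dyadic -muln2 natrM exprS invfM mulrA mulfK//.
have step : u * (1 - q ^+ l.+1) + u * (1 - q) * q ^+ l.+1 = u * (1 - q ^+ l.+2).
  by rewrite [q ^+ l.+2]exprS; ring.
have le_step : u * (1 - q ^+ l.+1) <= u * (1 - q ^+ l.+2).
  by rewrite -step lerDl mulr_ge0 ?exprn_ge0// mulr_ge0// subr_ge0.
rewrite -(odd_double_half j) in jl *; case: (odd j) jl => /= jl.
  have jl' : (j./2.*2 < 2 ^ l.+1)%N by rewrite -add1n.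
  rewrite add1n -step -[w _](subrK (w (dyadic R l.+1 j./2.*2))) addrC.
  apply: (le_trans (ler_normD _ _)); apply: lerD; last exact: winc.
  rewrite half; apply: IH.
  by move: jl'; rewrite expnS mul2n ltn_double => /ltnW.
rewrite add0n half; apply: le_trans le_step; apply: IH.
by move: jl; rewrite add0n expnS mul2n leq_double.
Qed.

Lemma dyadic_dense_bound (R : realType) (w : R -> R) (u : R) :
    {within `[0, +oo[, continuous w} ->
    (forall l j, (j <= 2 ^ l)%N -> `|w (dyadic R l j)| <= u) ->
  forall t, 0 <= t <= 1 -> `|w t| <= u.
Proof.
move=> /subspace_continuousP cw wu t /andP[t0 t1].
apply/ler_addgt0Pr => e e0.
have /cvgrPdist_le /(_ _ e0) : w @ within `[0, +oo[ (nbhs t) --> w t.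
  by apply: cw; rewrite /= in_itv/= t0.
rewrite /within /= => /nbhs_ballP[d /= d0 dP].
have [l ld] : exists l : nat, (2 ^+ l)^-1 < d.
  have : 2^-1 ^+ n @[n --> \oo] --> (0 : R).
    by apply: cvg_expr; rewrite ger0_norm ?invf_lt1 ?ltr1n.
  move=> /cvgrPdist_lt /(_ _ d0) [N _ /(_ N (leqnn N))].
  rewrite /= sub0r normrN ger0_norm ?exprn_ge0// exprVn => h; by exists N.
have p0 : 0 < 2 ^+ l :> R by rewrite exprn_gt0.
pose j := Num.truncn (t * 2 ^+ l).
have /andP[j1 j2] : j%:R <= t * 2 ^+ l < j.+1%:R.
  by apply: truncn_itv; rewrite mulr_ge0// ltW.
have jl : (j <= 2 ^ l)%N.
  rewrite -(ler_nat R) natrX (le_trans j1)// -[leRHS]mul1r ler_wpM2r// ltW.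
have h1 : dyadic R l j <= t by rewrite /dyadic ler_pdivrMr.
have h2 : t < dyadic R l j + (2 ^+ l)^-1.
  by rewrite /dyadic -[X in _ + X]mul1r -mulrDl ltr_pdivlMr// -[1](mulr1n 1) -natrD addn1.
have h0 : 0 <= dyadic R l j by rewrite /dyadic divr_ge0// ltW.
have := dP (dyadic R l j).
rewrite /ball /= in_itv /= h0 ger0_norm ?subr_ge0// => /(_ _ isT) close.
rewrite -[w t](subrK (w (dyadic R l j))) addrC.
apply: (le_trans (ler_normD _ _)); rewrite lerD ?wu//.
by apply: close; apply: lt_trans ld; rewrite ltrBlDl.
Qed.

(** The exceptional set is the union over all dyadic intervals of the events
    that the increment exceeds the amount that [dyadic_chaining] allows.  At
    level [l] there are [2^l] intervals, on each of which the Gaussian tail is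
    of order [u^-4 (4 q^4)^-l]; the sum converges as soon as [2 q^4 > 1]. *)
Lemma brownian_sup_tail (R : realType) (d : measure_display)
    (Omega : measurableType d) (P : probability Omega R)
    (F : R -> set_system Omega) (W : R -> Omega -> R) :
    filtration F -> brownian_motion P F W ->
  exists2 A : R, 0 < A & forall u, 1 <= u -> exists B : set Omega,
    [/\ measurable B, (P B <= (A / u)%:E)%E &
        forall w, ~ B w -> W 0 w = 0 ->
          {within `[0, +oo[, continuous (fun t => W t w)} ->
          forall t, 0 <= t <= 1 -> `|W t w| <= u].
Proof.
move=> [Fm _] [Wa _ _ Wn].
have mW t : 0 <= t -> measurable_fun setT (W t).
  move=> t0 _ Y mY; rewrite setTI; apply: (Fm t t0).2.
  exact: Wa.
(* [z = 1 / (2 q^4)] is the ratio of the geometric series of probabilities. *)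
pose q : R := 7 / 8; pose z : R := 2048 / 2401.
have q0 : 0 < q by rewrite /q; lra.
have z0 : 0 <= z by rewrite /z; lra.
have z1 : z < 1 by rewrite /z; lra.
pose K : R := Num.sqrt 2 * (64 * 8 ^+ 4).
have K0 : 0 < K by rewrite mulr_gt0 ?sqrtr_gt0.
exists (K / (1 - z)); first by rewrite divr_gt0// subr_gt0.
move=> u u1; have u0 : 0 < u by exact: lt_le_trans u1.
pose D := dyadic R.
pose E l j := increment W (D l j) (D l j.+1) @^-1` [set x | u * (1 - q) * q ^+ l < `|x|].
have D0 l j : 0 <= D l j by rewrite divr_ge0// exprn_ge0.
have DS l j : D l j < D l j.+1.
  by rewrite /D /dyadic ltr_pM2r ?invr_gt0 ?exprn_gt0// ltr_nat.
have mS (b : R) : measurable [set x : R | b < `|x|] by exact: measurable_norm_gt.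
have mE l j : measurable (E l j).
  rewrite /E -[X in measurable X]setTI.
  have mi : measurable_fun setT (increment W (D l j) (D l j.+1)).
    by apply: measurable_funB; exact: mW.
  by apply: mi => //; exact: mS.
have PE l j : (P (E l j) <= (K / u * (z ^+ l / 2 ^+ l))%:E)%E.
  have [-> _] := Wn _ _ (D0 l j) (DS l j) _ (mS (u * (1 - q) * q ^+ l)).
  (* [1 - q = 1 / 8] accounts for the factor [8 ^+ 4] of [K]. *)
  have DD : D l j.+1 - D l j = (2 ^+ l)^-1.
    by rewrite /D /dyadic -mulrBl -natr1 addrAC subrr add0r mul1r.
  rewrite DD; set s := Num.sqrt _.
  have s2 : s ^+ 2 = (2 ^+ l)^-1 by rewrite sqr_sqrtr// invr_ge0 exprn_ge0.
  have s0 : 0 < s by rewrite sqrtr_gt0 invr_gt0 exprn_gt0.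
  apply: le_trans (normal_prob_tail s0 _) _.
    by rewrite !mulr_gt0 ?exprn_gt0// /q; lra.
  rewrite lee_fin.
  have -> : (s / (u * (1 - q) * q ^+ l)) ^+ 4 = 8 ^+ 4 / u ^+ 4 * (z ^+ l / 2 ^+ l).
    have -> : (s / (u * (1 - q) * q ^+ l)) ^+ 4 =
        (s ^+ 2) ^+ 2 / (u * (1 - q) * q ^+ l) ^+ 4.
      by rewrite -exprM expr_div_n.
    rewrite s2.
    have -> : z ^+ l = (2 ^+ l * (q ^+ l) ^+ 4)^-1.
      have -> : z = (2 * q ^+ 4)^-1 by rewrite /z /q; lra.
      by rewrite exprVn exprMn exprAC.
    have -> : 1 - q = 8^-1 by rewrite /q; lra.
    have ql : q ^+ l != 0 by rewrite expf_neq0// gt_eqF.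
    have tl : 2 ^+ l != 0 :> R by rewrite expf_neq0.
    by field; rewrite tl ql gt_eqF.
  rewrite /K !mulrA ler_wpM2r ?invr_ge0 ?exprn_ge0// ler_wpM2r ?exprn_ge0//.
  by rewrite ler_wpM2l// lef_pV2 ?posrE ?exprn_gt0// ler_eXnr.
pose G l := \big[setU/set0]_(j < 2 ^ l) E l j.
have mG l : measurable (G l) by apply: bigsetU_measurable => j _; exact: mE.
have PG l : (P (G l) <= (K / u * z ^+ l)%:E)%E.
  apply: (@le_trans _ _ (\sum_(j < 2 ^ l) P (E l j))%E).
    have := @content_subadditive _ _ _ P (G l) (E l) (2 ^ l)%N.
    by rewrite /G; apply => //; exact: mG.
  apply: (@le_trans _ _ (\sum_(j < 2 ^ l) (K / u * (z ^+ l / 2 ^+ l))%:E)%E).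
    by apply: lee_sum => j _; exact: PE.
  rewrite sumEFin sumr_const card_ord lee_fin -[X in X <= _]mulr_natr natrX.
  by rewrite -!mulrA mulVf ?mulr1// expf_neq0.
exists (\bigcup_l G l); split.
- exact: bigcupT_measurable.
- apply: (@le_trans _ _ (\sum_(0 <= l <oo) P (G l))%E).
    by apply: measure_sigma_subadditive => //; exact: bigcupT_measurable.
  apply: (@le_trans _ _ (\sum_(0 <= l <oo) (K / u * z ^+ l)%:E)%E).
    by apply: lee_nneseries => [l _ _|l _]; [exact: measure_ge0|exact: PG].
  have cg : series (geometric (K / u) z) @ \oo --> K / u * (1 - z)^-1.
    by apply: cvg_geometric_series; rewrite ger0_norm.
  rewrite (_ : K / (1 - z) / u = K / u * (1 - z)^-1); last by rewrite mulrAC.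
  rewrite le_eqVlt; apply/orP; left; apply/eqP/cvg_lim => //.
  rewrite (_ : (fun n => _) = EFin \o series (geometric (K / u) z)).
    by apply: cvg_EFin => //; exact: nearW.
  by apply/funext => n /=; rewrite sumEFin.
- move=> w Bw w0 cw t t01; apply: (@dyadic_dense_bound _ (fun t => W t w) u cw _ t t01).
  apply: (@dyadic_chaining _ (fun t => W t w) u q) => //; first exact: ltW.
    by rewrite /q; apply/andP; split; lra.
  move=> l j jl; rewrite leNgt; apply/negP => h; apply: Bw.
  exists l => //; rewrite /G -bigcup_mkord; exists j => //.
Qed.

(** * Contraction of the finite-volume system over a unit of time *)

Lemma derive_ge0_left_max (R : realType) (g : R -> R) (t : R) : 0 < t ->
  derivable g t 1 -> (forall s, 0 <= s <= t -> g s <= g t) -> 0 <= 'D_1 g t.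
Proof.
move=> t0 dg gmax; rewrite leNgt; apply/negP => g'0.
have /cvgr_lt /(_ _ g'0) : (fun h => h^-1 *: (g (h + t) - g t)) @ 0^' --> 'D_1 g t.
  rewrite (_ : (fun h => _) = fun h => h^-1 *: ((g \o shift t) (h *: 1) - g t)); last first.
    by apply/funext => h /=; rewrite [h *: 1]mulr1.
  exact: dg.
rewrite /dnbhs /within /= => /nbhs_ballP[d /= d0 dP].
pose h := - Num.min (d / 2) t.
have h0 : 0 < - h by rewrite opprK lt_min t0 divr_gt0.
have hd : - h < d.
  by rewrite opprK gt_min; apply/orP; left; rewrite ltr_pdivrMr// mulr_natr mulr2n ltrDl.
have ht : - h <= t by rewrite opprK ge_min lexx orbT.
have := dP h; rewrite /ball /= sub0r gtr0_norm// hd => /(_ isT).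
have hn0 : h != 0 by rewrite -oppr_eq0 gt_eqF.
move=> /(_ hn0); apply/negP; rewrite -leNgt.
rewrite /GRing.scale /= -mulrNN -invrN mulr_ge0 ?invr_ge0 ?(ltW h0)//.
rewrite opprB subr_ge0 gmax//; apply/andP; split; lra.
Qed.

(** Here [s] is the sign of the largest coordinate [y] of the noise-free part,
    [m = s y], and [z] is the value of that site, noise included, while [l]
    and [r] are its neighbours.  The lower bound on [m] gives [m - u >= 1], so
    that [s z >= 1] and dividing the dissipativity inequality by [s z]
    gives [s f(z) <= eta - lambda (m - u)].  The neighbours contribute at most
    [2 M (m + u)], and [(lambda - 2 M) m > m / 2] yields the margin [c / 3]. *)
Lemma drift_inward (R : realType) (M eta lambda c u m : R) (s z l r b1 b2 fz : R) :
    0 < M -> 0 < eta -> 2 * M < lambda - 2^-1 -> 0 <= c -> 0 <= u ->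
    2 / 3 * c + (2 * (2 * M + lambda + eta) + 2) * (1 + u) <= m ->
    s = 1 \/ s = - 1 -> m - u <= s * z -> `|b1 * l| <= M * (m + u) ->
    `|b2 * r| <= M * (m + u) -> fz * z <= eta - lambda * `|z| ^+ 2 ->
  s * (b1 * l + b2 * r + fz) < - (c / 3).
Proof.
move=> M0 eta0 lM c0 u0 cm s1 sz lb rb fzz.
have lam0 : 0 < lambda by lra.
have Mu : 0 <= M * u by rewrite mulr_ge0// ltW.
have lu : 0 <= lambda * u by rewrite mulr_ge0// ltW.
have eu : 0 <= eta * u by rewrite mulr_ge0// ltW.
have mu1 : 1 <= m - u by nra.
have slb : s * (b1 * l) <= M * (m + u).
  by apply: le_trans lb; case: s1 => ->; rewrite ?mul1r ?mulN1r ?ler_norm// -normrN ler_norm.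
have srb : s * (b2 * r) <= M * (m + u).
  by apply: le_trans rb; case: s1 => ->; rewrite ?mul1r ?mulN1r ?ler_norm// -normrN ler_norm.
have sf : s * fz <= eta - lambda * (m - u).
  have y1 : 1 <= s * z by lra.
  have z2 : `|z| ^+ 2 = (s * z) ^+ 2.
    by rewrite real_normK ?num_real//; case: s1 => ->; ring.
  have fzE : fz * z = (s * fz) * (s * z) by case: s1 => ->; ring.
  rewrite z2 fzE in fzz.
  move: (s * z) (s * fz) y1 sz fzz => y g y1 my gy.
  have : g * y <= (eta - lambda * y) * y by nra.
  rewrite ler_pM2r; last by lra.
  nra.
have m0 : 0 <= m by lra.
have : 2^-1 * m <= (lambda - 2 * M) * m by rewrite ler_wpM2r//; lra.
nra.
Qed.

Lemma site_tnth (R : realType) n (x : n.-tuple R) (j : 'I_n) : site x j.+1 = tnth x j.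
Proof. by rewrite /site /= (tnth_nth 0). Qed.

Lemma site0 (R : realType) n (x : n.-tuple R) : site x 0 = 0.
Proof. by []. Qed.

Lemma site_gt (R : realType) n (x : n.-tuple R) i : (n < i)%N -> site x i = 0.
Proof. by case: i => // i ni; rewrite /site /= nth_default// size_tuple. Qed.

Lemma drift_continuous (R : realType) (a : nat -> nat -> R) (f : R -> R) n
    (x : R -> n.-tuple R) (A : set R) i :
    continuous f -> (forall i, {within A, continuous (fun t => site (x t) i)}) ->
  {within A, continuous (fun t => drift a f (x t) i)}.
Proof.
move=> cf cx t; rewrite /drift; apply: cvgD; first apply: cvgD.
- by apply: cvgM; [exact: cvg_cst|exact: cx].
- by apply: cvgM; [exact: cvg_cst|exact: cx].
- exact: (cvg_comp _ _ (cx i t) (cf _)).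
Qed.

(** Maximum principle.  Let [y] be the path minus its noise, which is
    differentiable, and let [b(t) = c (1 - t / 3) + C (1 + u)] be a barrier.  If
    some [|y_i(1)|] exceeded [b(1)], the maximum of [|y_i(t)| - b(t)] over all
    sites [i] and times [t] in [[0, 1]] would be positive, hence attained at a
    time [t > 0].  There site [i] dominates its neighbours, so that [|y_i|]
    decreases at a rate faster than [c / 3], the rate of [b]: the difference was
    larger just before [t].  Taking the maximum over the sites as well is what
    makes the bound independent of their number. *)
Lemma one_step_contraction (R : realType) (M eta lambda : R)
    (a : nat -> nat -> R) (f : R -> R) n (x0 : n.-tuple R)
    (x : R -> n.-tuple R) (w : R -> R) (c u : R) :
    0 < M -> 0 < eta -> 2 * M < lambda - 2^-1 ->
    (forall i, (2 <= i)%N -> Num.max `|a i.-1 i| `|a i i.-1| <= M) ->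
    continuous f -> (forall z, f z * z <= eta - lambda * `|z| ^+ 2) ->
    0 <= c -> 0 <= u ->
    (forall i, {within `[0, +oo[, continuous (fun t => site (x t) i)}) ->
    {within `[0, +oo[, continuous w} ->
    (forall t i, 0 <= t -> (1 <= i <= n)%N ->
       site (x t) i = site x0 i
         + (\int[lebesgue_measure]_(s in `[0, t]) drift a f (x s) i)
         + (i == 1%N)%:R * w t) ->
    (forall t, 0 <= t <= 1 -> `|w t| <= u) ->
    (forall i, `|site x0 i| <= c) ->
  forall i, `|site (x 1) i| <=
    2 / 3 * c + (2 * (2 * M + lambda + eta) + 3) * (1 + u).
Proof.
move=> M0 eta0 lM a_le cf f_dissip c0 u0 cx cw xE wu x0c.
have lam0 : 0 < lambda by lra.
set C := 2 * (2 * M + lambda + eta) + 2.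
have C0 : 2 <= C by rewrite /C; lra.
pose b t := c * (1 - t / 3) + C * (1 + u).
pose y (j : 'I_n) t := site (x t) j.+1 - (j.+1 == 1%N)%:R * w t.
have cy j : {within `[0, 1], continuous (y j)}.
  have s01 : `[0%R, 1%R]%classic `<=` (`[0, +oo[%classic : set R).
    by move=> t /=; rewrite !in_itv/= andbT => /andP[].
  move=> t; apply: cvgB; first exact: (continuous_subspaceW s01 (cx _)).
  by apply: cvgM; [exact: cvg_cst|exact: (continuous_subspaceW s01 cw)].
have yE j t : 0 <= t -> y j t = site x0 j.+1
    + \int[lebesgue_measure]_(s in `[0, t]) drift a f (x s) j.+1.
  by move=> t0; rewrite /y xE//= ?addrK// ltn_ord.
have noise_le j t : 0 <= t <= 1 -> `|(j == 1%N)%:R * w t| <= u.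
  by move=> t01; case: (j == 1%N); rewrite ?mul1r ?mul0r ?normr0// wu.
pose sg (e : bool) : R := if e then 1 else - 1.
have sgP e : sg e = 1 \/ sg e = - 1 by case: e; [left|right].
have norm_sg (z h : R) : (forall e, sg e * z <= h) -> `|z| <= h.
  move=> H; rewrite ler_norml -lerNl; apply/andP; split.
    by have := H false; rewrite mulN1r.
  by have := H true; rewrite mul1r.
(* The absolute value is split into its two signs to keep the functions
   differentiable. *)
pose phi (k : 'I_n * bool) t := sg k.2 * y k.1 t - b t.
have cphi k : {within `[0, 1], continuous (phi k)}.
  move=> t; apply: cvgB; first by apply: cvgM; [exact: cvg_cst|exact: cy].
  apply: cvgD; last exact: cvg_cst.
  apply: cvgM; first exact: cvg_cst.
  apply: cvgB; first exact: cvg_cst.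
  apply: cvgM; last exact: cvg_cst.
  by apply: continuous_subspaceT => s; exact: cvg_id.
have /boolp.choice[tau tauP] : forall k, exists t, t \in `[0, 1] /\
    forall s, s \in `[0, 1] -> phi k s <= phi k t.
  by move=> k; have [t t01 tmax] := EVT_max ler01 (cphi k); exists t.
suff phi_le k : phi k 1 <= 0.
  have y_le j : `|y j 1| <= b 1.
    by apply: norm_sg => e; rewrite -subr_le0; exact: (phi_le (j, e)).
  have b1 : b 1 = 2 / 3 * c + C * (1 + u) by rewrite /b; lra.
  have le_rhs : b 1 + u <= 2 / 3 * c + (2 * (2 * M + lambda + eta) + 3) * (1 + u).
    by rewrite b1 /C; lra.
  have bu0 : 0 <= b 1 + u by rewrite b1; nra.
  move=> i; apply: le_trans le_rhs.
  case: i => [|i]; first by rewrite site0 normr0.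
  have [ni|ni] := leqP i.+1 n; last by rewrite site_gt ?normr0.
  rewrite -[site _ _](subrK ((i.+1 == 1%N)%:R * w 1)).
  apply: (le_trans (ler_normD _ _)); apply: lerD.
    exact: (y_le (Ordinal ni)).
  by rewrite noise_le// ler01 lexx.
rewrite leNgt; apply/negP => phik.
have [k0 _ k0max] := @arg_maxP _ _ _ k xpredT (fun k => phi k (tau k)) isT.
set t := tau k0 in k0max.
have [] := tauP k0; rewrite -/t in_itv /= => /andP[t0 t1] tmax.
have v0 : 0 < phi k0 t.
  apply: lt_le_trans (k0max k isT); apply: lt_le_trans phik _.
  by apply: (tauP k).2; rewrite in_itv /= ler01 lexx.
have all_le k' : phi k' t <= phi k0 t.
  apply: le_trans (k0max k' isT).
  by apply: (tauP k').2; rewrite in_itv /= t0.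
case: k0 @t k0max t0 t1 tmax v0 all_le => i e t k0max t0 t1 tmax v0 all_le.
set m := sg e * y i t.
have bm : b t < m by rewrite -subr_gt0.
have y_le j : `|y j t| <= m.
  by apply: norm_sg => e'; have := all_le (j, e'); rewrite /phi /= lerD2r.
have b_ge : 2 / 3 * c + C * (1 + u) <= b t by rewrite /b; nra.
have b_pos : 0 < b t by nra.
have tpos : 0 < t.
  rewrite lt_neqAle t0 andbT; apply/eqP => t00; move: bm; rewrite /m -t00.
  rewrite yE// set_itv1 Rintegral_set1 addr0 ltNge => /negP; apply.
  apply: (@le_trans _ _ c).
    apply: le_trans (x0c i.+1); case: (sgP e) => ->.
      by rewrite mul1r ler_norm.
    by rewrite mulN1r -normrN ler_norm.
  by rewrite /b; nra.
have site_le j : `|site (x t) j| <= m + u.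
  have mu0 : 0 <= m + u by lra.
  case: j => [|j]; first by rewrite site0 normr0.
  have [nj|nj] := leqP j.+1 n; last by rewrite site_gt ?normr0.
  rewrite -[site _ _](subrK ((j.+1 == 1%N)%:R * w t)).
  apply: (le_trans (ler_normD _ _)); apply: lerD.
    exact: (y_le (Ordinal nj)).
  by rewrite noise_le// t0.
have inward : sg e * drift a f (x t) i.+1 < - (c / 3).
  rewrite /drift /=; apply: (@drift_inward _ M eta lambda c u m) => //.
  - by apply: le_trans (ltW bm); exact: b_ge.
  - have -> : site (x t) i.+1 = y i t + (i.+1 == 1%N)%:R * w t by rewrite subrK.
    rewrite mulrDr -/m lerD2l.
    have := noise_le i.+1 t; rewrite t0 t1 => /(_ isT).
    rewrite ler_norml => /andP[]; case: (sgP e) => ->; lra.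
  - case: (i : nat) => [|j]; first by rewrite site0 mulr0 normr0; nra.
    rewrite normrM ler_pM//.
    have := a_le j.+2 isT; rewrite ge_max => /andP[_]; exact.
  - rewrite normrM ler_pM//.
    have := a_le i.+2 isT; rewrite ge_max => /andP[]; exact.
have cdr : {within `[0, +oo[, continuous (fun s => drift a f (x s) i.+1)}.
  exact: drift_continuous.
pose I s := \int[lebesgue_measure]_(s in `[0, s]) drift a f (x s) i.+1.
(* Time runs up to 2 so that [t = 1] is interior to the interval. *)
have [dI I'] : derivable I t 1 /\ 'D_1 I t = drift a f (x t) i.+1.
  rewrite -derive1E.
  apply: (@continuous_FTC1 _ _ (BLeft 0) t 2).
  - by rewrite (le_lt_trans t1)// ltr1n.
  - apply: continuous_compact_integrable; first exact: segment_compact.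
    apply: continuous_subspaceW cdr => s /=.
    by rewrite !in_itv/= andbT => /andP[].
  - by rewrite lte_fin.
  - have : {within `]0, 2[, continuous (fun s => drift a f (x s) i.+1)}.
      apply: continuous_subspaceW cdr => s /=.
      by rewrite !in_itv/= andbT => /andP[/ltW].
    rewrite continuous_open_subspace; last exact: interval_open.
    by apply; rewrite inE /= in_itv /= tpos (le_lt_trans t1)// ltr1n.
pose g s := sg e * I s + c / 3 * s.
have dg : derivable g t 1.
  apply: derivableD; first exact: derivableZ.
  by apply: derivableZ; exact: derivable_id.
have gE : 'D_1 g t = sg e * drift a f (x t) i.+1 + c / 3.
  rewrite deriveD; [|exact: derivableZ|by apply: derivableZ; exact: derivable_id].
  by rewrite !deriveZ// I' derive_id [_ *: 1]mulr1.
have : 0 <= 'D_1 g t.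
  apply: derive_ge0_left_max => // s /andP[s0 st].
  have := tmax s; rewrite in_itv /= s0 (le_trans st t1) => /(_ isT).
  rewrite /phi /= !yE// -/(I s) -/(I t) /b /g; lra.
by rewrite gE; lra.
Qed.

(** * Tails of the invariant measures *)

(** The integral of a nonnegative function is a supremum over the simple
    functions below it, hence monotone even for non-measurable integrands, such
    as a transition probability seen as a function of the starting point. *)
Lemma ge0_le_integralT (d : measure_display) (T : measurableType d)
    (R : realType) (mu : {measure set T -> \bar R}) (f g : T -> \bar R) :
    (forall x, 0 <= f x)%E -> (forall x, f x <= g x)%E ->
  (\int[mu]_x f x <= \int[mu]_x g x)%E.
Proof.
move=> f0 fg; have g0 x : (0 <= g x)%E by exact: le_trans (fg x).
rewrite !ge0_integralTE//; apply: le_ereal_sup.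
by move=> _ [h hf <-]; exists h => // x; exact: le_trans (fg x).
Qed.

Definition outside_box (R : realType) n (c : R) : set (n.-tuple R) :=
  [set x | ~ forall i, `|site x i| <= c].

Lemma measurable_site (R : realType) n i :
  measurable_fun setT (fun x : n.-tuple R => site x i).
Proof.
case: i => [|i]; first exact: measurable_cst.
have [ni|ni] := leqP i.+1 n.
  rewrite (_ : (fun x => _) = (@tnth n R)^~ (Ordinal ni)).
    exact: measurable_tnth.
  by apply/funext => x; rewrite -site_tnth.
rewrite (_ : (fun x => _) = cst 0); first exact: measurable_cst.
by apply/funext => x; rewrite site_gt.
Qed.

Lemma outside_box_measurable (R : realType) n (c : R) :
  measurable (@outside_box R n c).
Proof.
have -> : @outside_box R n c =
    \bigcup_i ((fun x => site x i) @^-1` [set z | c < `|z|]).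
  apply/seteqP; split => x /=.
    by move=> /existsNP[i /negP]; rewrite -ltNge => ci; exists i.
  by move=> [i _ /= ci] H; have := H i; rewrite leNgt ci.
apply: bigcupT_measurable => i; rewrite -[X in measurable X]setTI.
by apply: measurable_site => //; exact: measurable_norm_gt.
Qed.

Lemma outside_box_cvg (R : realType) n (mu : probability (n.-tuple R) R) (c : R) :
  0 < c -> mu (outside_box (c * (5 / 4) ^+ k)) @[k --> \oo] --> 0%E.
Proof.
move=> c0; pose r : R := 5 / 4; have r1 : 1 < r by rewrite /r; lra.
have r0 : 0 < r by rewrite /r; lra.
have ck0 k : 0 <= c * r ^+ k by rewrite mulr_ge0 ?exprn_ge0// ltW.
have cap0 : \bigcap_k @outside_box R n (c * r ^+ k) = set0.
  apply/seteqP; split => // x xB.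
  pose b := \sum_(j < n) `|tnth x j|.
  have xb i : `|site x i| <= b.
    have b0 : 0 <= b by rewrite sumr_ge0.
    case: i => [|i]; first by rewrite site0 normr0.
    have [ni|ni] := leqP i.+1 n; last by rewrite site_gt ?normr0.
    have -> : site x i.+1 = tnth x (Ordinal ni) by rewrite -site_tnth.
    by rewrite /b (bigD1 (Ordinal ni))//= lerDl sumr_ge0.
  have [k bk] : exists k, b <= c * r ^+ k.
    have b0 : 0 < b + 1 by rewrite ltr_wpDl// sumr_ge0.
    have : (5 / 4)^-1 ^+ k @[k --> \oo] --> (0 : R).
      by apply: cvg_expr; rewrite ger0_norm ?invr_ge0 ?invf_lt1 ?(ltW r0).
    move=> /cvgrPdist_lt /(_ _ (divr_gt0 c0 b0)) [N _ /(_ N (leqnn N))].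
    rewrite /= sub0r normrN ger0_norm ?exprn_ge0 ?invr_ge0 ?(ltW r0)//.
    rewrite exprVn -/r ltr_pdivlMr// mulrC ltr_pdivrMr ?exprn_gt0// => h.
    by exists N; apply: ltW; apply: lt_trans h; rewrite ltrDl.
  by apply: (xB k I) => i; exact: le_trans (xb i) bk.
rewrite -(measure0 mu) -cap0.
apply: (@nonincreasing_cvg_mu _ _ _ mu
  (fun k => @outside_box R n (c * r ^+ k))).
- by rewrite ltey_eq fin_num_measure//; exact: outside_box_measurable.
- by move=> k; exact: outside_box_measurable.
- by rewrite cap0; exact: measurable0.
- move=> k l kl; apply/subsetPset => x xl H; apply: xl => i.
  by apply: le_trans (H i) _; rewrite ler_pM2l// ler_weXn2l// ltW.
Qed.

(** [5 A / c] solves [S(c) = S(5 c / 4) + A / c], so that [T - S] does not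
    decrease along [c (5/4)^k], where [T] tends to 0. *)
Lemma le_of_dilation_step (R : realType) (T : R -> R) (A c1 : R) :
    0 <= A -> 0 < c1 ->
    (forall c, c1 <= c -> T c <= T (c * (5 / 4)) + A / c) ->
    (forall c, 0 < c -> T (c * (5 / 4) ^+ k) @[k --> \oo] --> 0) ->
  forall c, c1 <= c -> T c <= 5 * A / c.
Proof.
move=> A0 c10 T1 Tlim c c1c.
have H k : forall c, c1 <= c -> T c <= T (c * (5 / 4) ^+ k) + 5 * A / c.
  elim: k => [|k IH] {}c {}c1c; have c0 : 0 < c by exact: lt_le_trans c1c.
    by rewrite expr0 mulr1 lerDl divr_ge0// ?mulr_ge0// ltW.
  apply: (le_trans (T1 c c1c)).
  have /IH : c1 <= c * (5 / 4) by lra.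
  rewrite -mulrA -exprS => h.
  have -> : 5 * A / c = 5 * A / (c * (5 / 4)) + A / c by field; rewrite gt_eqF.
  by rewrite addrA lerD2r.
have c0 : 0 < c by exact: lt_le_trans c1c.
have : T (c * (5 / 4) ^+ k) + 5 * A / c @[k --> \oo] --> 0 + 5 * A / c.
  by apply: cvgD; [exact: Tlim|exact: cvg_cst].
rewrite add0r => L; rewrite -(cvg_lim _ L)//; apply: limr_ge.
  by apply/cvg_ex; eexists; exact: L.
by apply: nearW => k; exact: H.
Qed.

Lemma invariant_step (R : realType) (d : measure_display)
    (Omega : measurableType d) (P : probability Omega R) n
    (X : n.-tuple R -> R -> Omega -> n.-tuple R)
    (mu : probability (n.-tuple R) R) (B B' : set (n.-tuple R)) (p : R) :
    invariant_measure P X mu -> measurable B -> measurable B' -> 0 <= p ->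
    (forall x, ~ B' x -> (P (X x 1%R @^-1` B) <= p%:E)%E) ->
    (forall x, (P (X x 1%R @^-1` B) <= 1)%E) ->
  (mu B <= mu B' + p%:E)%E.
Proof.
move=> inv mB mB' p0 PB PB1; rewrite (inv 1 ler01 B mB).
apply: (@le_trans _ _ (\int[mu]_x ((\1_B' x)%:E + p%:E))%E).
  apply: ge0_le_integralT => // x; rewrite indicE.
  have [xB|xB] := pselect (B' x).
    by rewrite mem_set//=; apply: le_trans (PB1 x) _; rewrite leeDl// lee_fin.
  by rewrite memNset//= add0e PB.
rewrite ge0_integralD//=; last first.
  by apply/measurable_EFinP; exact: measurable_indic.
rewrite integral_indic// setIT integral_cst//.
rewrite [X in (_ * X)%E](_ : _ = 1%E); last exact: probability_setT.
by rewrite mule1.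
Qed.

(** If [|W| <= u] on [[0, 1]], one unit of time maps the cube of size [5 c / 4]
    into the cube of size [2/3 (5 c / 4) + D (1 + u)].  This equals [c] for
    [D (1 + u) = c / 6], and then [u] is of order [c]. *)
Lemma transition_tail (R : realType) (d : measure_display)
    (Omega : measurableType d) (P : probability Omega R)
    (F : R -> set_system Omega) (W : R -> Omega -> R)
    (M eta lambda : R) (a : nat -> nat -> R) (f : R -> R) :
    filtration F -> brownian_motion P F W ->
    0 < M -> 0 < eta -> 2 * M < lambda - 2^-1 ->
    (forall i, (2 <= i)%N -> Num.max `|a i.-1 i| `|a i i.-1| <= M) ->
    continuous f -> (forall z, f z * z <= eta - lambda * `|z| ^+ 2) ->
  exists A c1 : R, [/\ 0 < A, 0 < c1 &
    forall n (x0 : n.-tuple R) (X : R -> Omega -> n.-tuple R) (c : R),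
      solution P F W a f x0 X -> c1 <= c ->
      (forall i, `|site x0 i| <= c * (5 / 4)) ->
      (P (X 1%R @^-1` outside_box c) <= (A / c)%:E)%E].
Proof.
move=> Ffil WB M0 eta0 lM a_le cf f_dissip.
have [A A0 supW] := brownian_sup_tail Ffil WB.
have lam0 : 0 < lambda by lra.
set D := 2 * (2 * M + lambda + eta) + 3.
have D0 : 0 < D by rewrite /D; lra.
exists (12 * D * A), (12 * D); split; try by rewrite !mulr_gt0.
move=> n x0 X c [Xa Xc XE] c1c x0c.
have c0 : 0 < c by apply: lt_le_trans c1c; rewrite mulr_gt0.
pose u := c / (6 * D) - 1.
have Du : D * (1 + u) = c / 6 by rewrite /u; field; rewrite gt_eqF.
have u_ge : c / (12 * D) <= u.
  have : 1 <= c / (12 * D) by rewrite ler_pdivlMr ?mul1r// mulr_gt0.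
  have -> : u = c / (12 * D) + c / (12 * D) - 1 by rewrite /u; field; rewrite gt_eqF.
  lra.
have u1 : 1 <= u.
  by apply: le_trans u_ge; rewrite ler_pdivlMr ?mul1r// mulr_gt0.
have [Bad [mBad PBad BadP]] := supW u u1.
case: WB => _ W0 Wc _.
pose regular w := [/\ W 0 w = 0,
    {within `[0, +oo[, continuous (fun t => W t w)},
    forall i, {within `[0, +oo[, continuous (fun t => site (X t w) i)} &
    forall t i, 0 <= t -> (1 <= i <= n)%N -> site (X t w) i = site x0 i
      + (\int[lebesgue_measure]_(s in `[0, t]) drift a f (X s w) i)
      + (i == 1%N)%:R * W t w].
have [N [mN PN NP]] : {ae P, forall w, regular w}.
  by apply: filterS2 (filterI W0 Wc) (filterI Xc XE) => w [? ?] [? ?].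
have mX : measurable (X 1 @^-1` outside_box c).
  apply: (Ffil.1 1 ler01).2; apply: Xa => //; exact: outside_box_measurable.
have sub : X 1 @^-1` outside_box c `<=` Bad `|` N.
  move=> w Xw; have [wN|wN] := pselect (N w); [by right|left].
  apply: contrapT => wBad; apply: Xw.
  have [] : regular w by apply: contrapT => wQ; apply: wN; exact: NP.
  move=> w00 wc xc xE i.
  have := @one_step_contraction R M eta lambda a f n x0 (X^~ w) (W^~ w)
    (c * (5 / 4)) u M0 eta0 lM a_le cf f_dissip _ _ xc wc xE (BadP w wBad w00 wc) x0c i.
  rewrite -/D Du.
  have -> : 2 / 3 * (c * (5 / 4)) + c / 6 = c by lra.
  by apply; lra.
apply: (@le_trans _ _ (P (Bad `|` N))).
  by apply: le_measure; rewrite ?inE//; exact: measurableU.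
apply: (le_trans (measureU2 _ _ _)) => //.
rewrite [X in (_ + X)%E]PN adde0; apply: (le_trans PBad); rewrite lee_fin.
rewrite ler_pdivrMr; last by lra.
have -> : 12 * D * A / c * u = A * (12 * D / c * u) by ring.
rewrite ler_peMr ?(ltW A0)//.
have -> : 12 * D / c * u = u / (c / (12 * D)) by rewrite invf_div mulrC.
by rewrite ler_pdivlMr ?mul1r// divr_gt0// mulr_gt0.
Qed.

(** * Tightness *)

Theorem lemma3p27 (R : realType)
  (theta M N eta lambda eta0 Rad : R)
  (theta_ge1 : 1 <= theta) (M_gt0 : 0 < M) (N_gt0 : 0 < N) (eta_gt0 : 0 < eta)
  (lambda_gt : 2^-1 < lambda) (eta0_ge0 : 0 <= eta0) (Rad_ge1 : 1 <= Rad)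
  (rho : nat -> {posnum R})
  (rho_sum : (\sum_(1 <= i <oo) ((rho i)%:num)%:E < +oo)%E)
  (rho_ratio : forall g j : nat, (1 <= g)%N -> (1 <= j)%N ->
     `|g%:R - j%:R| <= Rad -> (rho g)%:num / (rho j)%:num <= N)
  (a : nat -> nat -> R)
  (a_neq0 : forall i, (2 <= i)%N -> a i i.-1 != 0)
  (a_le : forall i, (2 <= i)%N -> Num.max (`|a i.-1 i|) (`|a i i.-1|) <= M)
  (f : R -> R)
  (f_smooth : forall (k : nat) (z : R), derivable (derive1n k f) z 1)
  (f_dissip : forall z, f z * z <= eta - lambda * `|z| ^+ 2)
  (f_growth : forall z, `|f z| <= eta0 * (1 + `|z| `^ theta))
  (M_small : 2 * M < lambda - 2^-1)
  (r M1 M2 : R) (r_gt0 : 0 < r) (M1_gt0 : 0 < M1) (M2_gt0 : 0 < M2)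
  (N1 : nat) (N1_ge1 : (1 <= N1)%N)
  (rho_lower : forall n, (N1 <= n)%N -> M1 * expR (- (r * n%:R)) <= (rho n)%:num)
  (rho_limsup :
     (limn_esup (fun n =>
        ((rho n)%:num /
         inf [set (rho i)%:num | i in [set i : nat | (1 <= i <= n)%N]])%:E)
      <= M2%:E)%E)
  (f1 f2 f3 : R -> R)
  (f_split : forall z, f z = f1 z + f2 z + f3 z)
  (f2_lip : exists K : R, forall z z', `|f2 z - f2 z'| <= K * `|z - z'|)
  (xi : R)
  (f3_decr : {homo (fun z => f3 z + xi * z) : x y / x <= y >-> y <= x})
  (L : nat -> {posnum R})
  (f1_lip : forall (n : nat) (z z' : R),
     - n%:R <= z <= n%:R -> - n%:R <= z' <= n%:R ->
     `|f1 z - f1 z'| <= (L n)%:num * `|z - z'|)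
  (L_growth : forall C : R, 0 < C -> exists2 g : R, 0 < g &
     (fun n : nat => expR (C * (L n)%:num ^+ 2) / (n%:R `^ g * (L n)%:num))
       @ \oo --> (0 : R))
  (lambda_large : (2 * M * N + 2 * (2 * theta - 1) * M) / (2 * theta)
     + theta + eta + (2 * theta)^-1 - 2^-1 < lambda)
  (v : nat -> {posnum R})
  (v_sum : (\sum_(1 <= i <oo) ((v i)%:num)%:E < +oo)%E)
  (rho_v_sum : (\sum_(1 <= i <oo) ((rho i)%:num / (v i)%:num)%:E < +oo)%E)
  (d : measure_display) (Omega : measurableType d) (P : probability Omega R)
  (F : R -> set_system Omega) (F_filtration : filtration F)
  (W : R -> Omega -> R) (W_brownian : brownian_motion P F W)
  (X : forall n : nat, n.-tuple R -> R -> Omega -> n.-tuple R)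
  (X_solution : forall (n : nat) (x : n.-tuple R), (1 <= n)%N ->
     solution P F W a f x (X n x))
  (mu : forall n : nat, probability (n.-tuple R) R)
  (mu_invariant : forall n, (1 <= n)%N -> unique_invariant_measure P (X n) (mu n)) :
  tight_in_lp (ge1_mul2 theta_ge1) rho (fun n => image_measure (mu n)).
Proof.
have cf : continuous f.
  move=> z; apply/differentiable_continuous/derivable1_diffP.
  exact: (f_smooth 0%N z).
have [A [c1 [A0 c10 tail]]] := transition_tail F_filtration W_brownian
  M_gt0 eta_gt0 M_small a_le cf f_dissip.
have mu_tail n c : (1 <= n)%N -> c1 <= c ->
    (mu n (outside_box c) <= (5 * A / c)%:E)%E.
  move=> n1 c1c; have mB := @outside_box_measurable R n.
  have fin t : mu n (outside_box t) \is a fin_num by apply: fin_num_measure.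
  rewrite -(fineK (fin c)) lee_fin.
  apply: (@le_of_dilation_step R (fun t => fine (mu n (outside_box t))) A c1) => //.
  - exact: ltW.
  - move=> t c1t; rewrite -lee_fin EFinD /= !fineK//.
    have t0 : 0 < t by exact: lt_le_trans c1t.
    have [inv _] := mu_invariant n n1.
    apply: (invariant_step inv) => //.
    + by rewrite divr_ge0 ?ltW.
    + move=> x /contrapT xt; exact: tail n x (X n x) t (X_solution n x n1) c1t xt.
    + move=> x; apply: probability_le1.
      have [Xa _ _] := X_solution n x n1.
      by apply: (F_filtration.1 1 ler01).2; exact: Xa.
  - by move=> t t0; exact: (fine_cvg (outside_box_cvg (mu n) t0)).
move=> e e0; pose c := Num.max c1 (5 * A / e).
have c0 : 0 < c by rewrite lt_max c10.
exists [set x : lp (ge1_mul2 theta_ge1) rho | forall k, `|x k| <= c].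
  exact: compact_lp_box.
move=> n n1; rewrite /image_measure.
have -> : @chi R n @^-1` (~` (@lp_val R _ _ rho @`
    [set x : lp (ge1_mul2 theta_ge1) rho | forall k, `|x k| <= c])) =
    outside_box c.
  apply/seteqP; split => x /=.
    move=> nK xc; apply: nK.
    have chi_le k : `|chi x k| <= c by exact: xc.
    have p0 : 0 <= 2 * theta by lra.
    by exists (Lp (ge1_mul2 theta_ge1) (bounded_in_lp p0 rho_sum chi_le)).
  move=> xB [y yc yx]; apply: xB => -[|i]; first by rewrite site0 normr0 ltW.
  by have := yc i; rewrite yx.
apply: (le_trans (mu_tail n c n1 _)); first by rewrite le_max lexx.
rewrite lee_fin ler_pdivrMr// [e * c]mulrC -ler_pdivrMr//.
by rewrite le_max lexx orbT.
Qed.
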